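(* Let $k$ and $t$ be positive integers with $t\geqslant k$, and let $N_1,N_2,\ldots,N_t$ be matroids on the same finite ground set $E$ such that $\chi(N_i)\leqslant k$ for all $i=1,2,\ldots,t$. Suppose that to each element $e\in E$ a list $L(e)\subseteq\{1,2,\ldots,t\}$ with $|L(e)|=k$ is assigned. Then there is a coloring $f:E\rightarrow\{1,2,\ldots,t\}$ such that (i) $f(e)\in L(e)$ for every $e\in E$, and (ii) $f^{-1}(i)$ is independent in $N_i$ for all $i=1,2,\ldots,t$.
   Context: For a matroid $M$ on a finite set $E$, a coloring of $E$ is proper if each color class is independent in $M$; the chromatic number $\chi(M)$ is the least number of colors in a proper coloring of $E$, i.e. the least number of independent sets of $M$ whose union is $E$. Matroids are tacitly assumed to have no loops, so that $\chi(M)$ is finite. *)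

(* Defs.v *)
From mathcomp Require Import all_boot.

Set Implicit Arguments.
Unset Strict Implicit.
Unset Printing Implicit Defensive.

Record matroid (E : finType) := Matroid {
  indep : pred {set E};
  indep0 : indep set0;
  indep_sub : forall A B : {set E}, A \subset B -> indep B -> indep A;
  indep_aug : forall A B : {set E}, indep A -> indep B -> #|A| < #|B| ->
    exists2 x, x \in B :\: A & indep (x |: A)
}.

Definition loopless (E : finType) (M : matroid E) : Prop :=
  forall e : E, indep M [set e].

Definition color_class (E C : finType) (f : {ffun E -> C}) (c : C) : {set E} :=
  [set e | f e == c].

Definition proper_coloring (E C : finType) (M : matroid E)
    (f : {ffun E -> C}) : bool :=
  [forall c, indep M (color_class f c)].

(* M has a proper coloring with (at most) n colors; color classes may be
   empty. *)
Definition colorable (E : finType) (M : matroid E) (n : nat) : bool :=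
  [exists f : {ffun E -> 'I_n}, proper_coloring M f].

Lemma loopless_colorable (E : finType) (M : matroid E) :
  loopless M -> exists n, colorable M n.
Proof.
move=> M_loopless; exists #|E|; apply/existsP.
exists [ffun e => enum_rank e]; apply/forallP => c.
apply: indep_sub (M_loopless (enum_val c)).
apply/subsetP => e; rewrite !inE ffunE => /eqP <-.
by rewrite enum_rankK.
Qed.

(* A matroid with a loop has no proper coloring, so the chromatic number takes
   looplessness as an argument; its value does not depend on the proof. *)
Definition chromatic_number (E : finType) (M : matroid E)
    (M_loopless : loopless M) : nat :=
  ex_minn (loopless_colorable M_loopless).
Arguments chromatic_number {E} M M_loopless.

(* Main.v *)
(** The coloring exists as soon as, for every [A],
    [#|A| <= \sum_i r_i {e in A | i \in L e}], where [r_i] is the rank of [N_i].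
    Rado's argument shows this: if some list contains two distinct colors, one
    of them can be deleted without violating the condition, by submodularity of
    the ranks; when all lists are singletons, the condition for [A = E] forces
    every color class to be independent.  The condition holds here because
    [#|B| <= k * r_i B] for every [B], as [N_i] is [k]-colorable. *)

Require Import Defs.
From mathcomp Require Import all_boot.
From mathcomp Require Import zify.

Definition rank {E : finType} (M : matroid E) (A : {set E}) : nat :=
  \max_(I : {set E} | indep M I && (I \subset A)) #|I|.

Section Rank.
Variables (E : finType) (M : matroid E).
Implicit Types A B I : {set E}.

Lemma rank_max {A I} : indep M I -> I \subset A -> #|I| <= rank M A.
Proof. by move=> MI sIA; apply: leq_bigmax_cond; rewrite MI. Qed.

Lemma rank_basis A :
  exists I, [/\ indep M I, I \subset A & #|I| = rank M A].
Proof.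
have : 0 < #|[pred I : {set E} | indep M I && (I \subset A)]|.
  by apply/card_gt0P; exists set0; rewrite inE indep0 sub0set.
case/(eq_bigmax_cond (fun I : {set E} => #|I|)) => I /andP[MI sIA] eqI.
by exists I; split=> //; rewrite /rank eqI.
Qed.

Lemma rank_mono {A B} : A \subset B -> rank M A <= rank M B.
Proof.
by have [I [MI sIA <-]] := rank_basis A => sAB; apply/rank_max/(subset_trans sIA).
Qed.

Lemma rank_leq_card A : rank M A <= #|A|.
Proof. by have [I [_ sIA <-]] := rank_basis A; apply: subset_leq_card. Qed.

Lemma rank_full_indep {A} : #|A| <= rank M A -> indep M A.
Proof.
have [I [MI sIA <-]] := rank_basis A => leAI.
by have /eqP <- : I == A by rewrite eqEcard sIA.
Qed.

Lemma indep_extend {A I} : indep M I -> I \subset A ->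
  exists J, [/\ indep M J, I \subset J, J \subset A & #|J| = rank M A].
Proof.
move: {2}(rank M A - #|I|) (leqnn (rank M A - #|I|)) => n.
elim: n I => [|n IHn] I ltn MI sIA; have leI := rank_max MI sIA.
  by exists I; split=> //; lia.
have [eqI|neI] := eqVneq #|I| (rank M A); first by exists I; split.
have [B [MB sBA cB]] := rank_basis A.
have ltIB : #|I| < #|B| by rewrite cB; lia.
have [x /setDP[Bx nIx] MxI] := indep_aug MI MB ltIB.
have cxI : #|x |: I| = #|I|.+1 by rewrite cardsU1 nIx.
have [|||J [MJ sxIJ sJA cJ]] := IHn (x |: I) => //; first by rewrite cxI; lia.
  by rewrite subUset sub1set (subsetP sBA) // sIA.
by exists J; split=> //; apply: subset_trans sxIJ; apply: subsetUr.
Qed.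

(** Extend a largest independent subset [I] of [A :&: B] to a largest independent subset [J] of
    [A :|: B]. The traces of [J] on [A] and [B] are independent, and their sizes add up to [#|J|]
    plus the size of [J :&: (A :&: B)], which contains [I]. *)
Lemma rank_submod A B :
  rank M (A :|: B) + rank M (A :&: B) <= rank M A + rank M B.
Proof.
have [I [MI sIAB <-]] := rank_basis (A :&: B).
have sIU : I \subset A :|: B.
  by apply: subset_trans sIAB _; rewrite subIset // subsetUl.
have [J [MJ sIJ sJAB <-]] := indep_extend MI sIU.
have leJ C : #|J :&: C| <= rank M C.
  by apply: rank_max (subsetIr _ _); apply: indep_sub MJ; apply: subsetIl.
apply: leq_trans (leq_add (leJ A) (leJ B)).
rewrite -[leqRHS]cardsUI -setIUr -setIIr (setIidPl sJAB) leq_add2l subset_leq_card //.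
by rewrite subsetI sIJ.
Qed.

(** A proper coloring splits [A] into [n] independent pieces, each of size at most the rank of
    [A]. *)
Lemma colorable_card_leq {n} A : colorable M n -> #|A| <= n * rank M A.
Proof.
case/existsP=> f /forallP Mf.
rewrite -sum1_card (partition_big f predT) //= -[n in n * _]card_ord -sum_nat_const.
apply: leq_sum => c _; rewrite sum1dep_card; apply: rank_max.
  by apply: indep_sub (Mf c); apply/subsetP => e; rewrite !inE => /andP[].
by apply/subsetP => e; rewrite !inE => /andP[].
Qed.

Lemma chromatic_colorable (lM : loopless M) : colorable M (chromatic_number M lM).
Proof. by rewrite /chromatic_number; case: ex_minnP. Qed.

End Rank.

Section ListColoring.
Variables (E C : finType) (N : C -> matroid E).
Implicit Types (L : E -> {set C}) (A : {set E}).

Definition allowed L A (c : C) : {set E} := [set e in A | c \in L e].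

Definition rado_condition L : Prop :=
  forall A, #|A| <= \sum_c rank (N c) (allowed L A c).

Definition drop_color L (e : E) (c : C) : E -> {set C} :=
  fun x => if x == e then L x :\ c else L x.

Lemma drop_color_sub L e c x : drop_color L e c x \subset L x.
Proof. by rewrite /drop_color; case: ifP => // _; apply: subsetDl. Qed.

Lemma drop_color_violation {L e c} : rado_condition L ->
  [\/ rado_condition (drop_color L e c) |
      exists2 A : {set E}, e \in A &
        \sum_d rank (N d) (allowed (drop_color L e c) A d) < #|A|].
Proof.
move=> radoL.
case: (boolP [forall A : {set E},
    #|A| <= \sum_d rank (N d) (allowed (drop_color L e c) A d)]).
  by move/forallP => rado'; left.
case/forallPn=> A; rewrite -ltnNge => ltA; right; exists A => //.
(* A set avoiding [e] sees the same lists before and after the deletion, so it cannot become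
   violating. *)
apply: contraLR ltA => nAe; rewrite -leqNgt.
apply: leq_trans (radoL A) _; apply: leq_sum => d _; apply: rank_mono.
apply/subsetP=> x; rewrite !inE => /andP[Ax Lx]; rewrite Ax /drop_color.
by case: eqP Ax nAe => // ->->.
Qed.

Lemma rado_drop_color {L e c d} : c != d -> rado_condition L ->
  rado_condition (drop_color L e c) \/ rado_condition (drop_color L e d).
Proof.
move=> neq_cd radoL.
have [|[A Ae ltA]] := drop_color_violation (e := e) (c := c) radoL; first by left.
have [|[B Be ltB]] := drop_color_violation (e := e) (c := d) radoL; first by right.
have ABe : e \in A :&: B by rewrite inE Ae.
have cardD := cardsD1 e (A :&: B); rewrite ABe in cardD.
have cardU := cardsUI A B.
(* The two violations bound the right-hand side by [#|A| + #|B| - 2]. The condition for [L] bounds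
   the left-hand side below by [#|A :|: B| + #|A :&: B| - 1], which is [#|A| + #|B| - 1]: removing
   [e] from the intersection costs only one. *)
suff : \sum_b rank (N b) (allowed L (A :|: B) b)
     + \sum_b rank (N b) (allowed L ((A :&: B) :\ e) b)
    <= \sum_b rank (N b) (allowed (drop_color L e c) A b)
     + \sum_b rank (N b) (allowed (drop_color L e d) B b).
  by have := radoL (A :|: B); have := radoL ((A :&: B) :\ e); lia.
rewrite -!big_split; apply: leq_sum => b _ /=.
apply: leq_trans (rank_submod _ _ _ _).
apply: leq_add; apply: rank_mono; apply/subsetP => x; rewrite !inE /drop_color.
  (* At [e] itself, a color [b] of [L e] differs from [c] or from [d], so it survives one of the two
     deletions. The intersection term needs [e] removed, since [c] and [d] each survive only one. *)
  case: (eqVneq x e) => [->|_]; last by rewrite -andb_orl.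
  rewrite Ae Be !inE /= => Lb; rewrite Lb !andbT.
  by have [-> //|] := eqVneq b c.
by case/andP=> /andP[/negPf-> /andP[-> ->]] ->.
Qed.

Lemma rado_nonempty {L} e : rado_condition L -> 0 < #|L e|.
Proof.
move=> radoL; rewrite card_gt0; apply: contraTneq (radoL [set e]) => L0.
rewrite cards1 -ltnNge ltnS leqn0; apply/eqP/big1 => c _; apply/eqP.
rewrite -leqn0 (leq_trans (rank_leq_card _ _ _)) // leqn0 cards_eq0.
by apply/eqP/setP => x; rewrite !inE; case: eqP => // ->; rewrite L0 inE.
Qed.

Lemma rado_singletons {f : {ffun E -> C}} : rado_condition (fun e => [set f e]) ->
  forall c, indep (N c) (color_class f c).
Proof.
move=> /(_ setT) radof.
have allowedE c : allowed (fun e => [set f e]) setT c = color_class f c.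
  by apply/setP => e; rewrite !inE eq_sym.
have cardE : #|[set: E]| = \sum_c #|color_class f c|.
  rewrite -sum1_card (partition_big f predT) //=; apply: eq_bigr => c _.
  by rewrite sum1dep_card; apply: eq_card => e; rewrite !inE.
(* Each rank is at most the size of its class, and the sizes sum to [#|E|]; the condition for the
   whole ground set thus forces equality class by class. *)
have := @leqif_sum C predT (fun c => rank (N c) (color_class f c) == #|color_class f c|)
  (fun c => rank (N c) (color_class f c)) (fun c => #|color_class f c|)
  (fun c _ => leqif_eq (rank_leq_card E (N c) (color_class f c))).
case=> leS; rewrite eqn_leq leS /= -cardE.
under eq_bigr do rewrite -allowedE.
rewrite radof => /esym/forallP eqr c.
by apply: rank_full_indep; rewrite (eqP (eqr c)).
Qed.

Lemma rado_list_coloring {L} : rado_condition L ->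
  exists f : {ffun E -> C},
    (forall e, f e \in L e) /\ (forall c, indep (N c) (color_class f c)).
Proof.
move: {2}(\sum_e #|L e|) (leqnn (\sum_e #|L e|)) => n.
elim: n L => [|n IHn] L leLn radoL.
  (* The lists are nonempty, so a total list size of zero means that [E] is empty. *)
  have noE (e : E) : False.
    by have := rado_nonempty e radoL; rewrite (bigD1 e) //= in leLn; lia.
  have f : {ffun E -> C} by apply: finfun => e; case: (noE e).
  exists f; split=> [e|c]; first by case: (noE e).
  have -> : color_class f c = set0 by apply/setP => e; case: (noE e).
  exact: indep0.
have [/existsP[e]|] := boolP [exists e, 1 < #|L e|].
  case/card_gt1P=> c [d [Lc Ld neq_cd]].
  have drop b : b \in L e -> rado_condition (drop_color L e b) ->
    exists f : {ffun E -> C},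
      (forall e, f e \in L e) /\ (forall c, indep (N c) (color_class f c)).
    move=> Lb radob.
    have [||f [fL Nf]] := IHn (drop_color L e b) => //.
      (* Deleting [b] from [L e] lowers the total list size by one. *)
      rewrite -ltnS (leq_trans _ leLn) // (bigD1 e) //= [ltnRHS](bigD1 e) //=.
      rewrite /drop_color eqxx (cardsD1 b (L e)) Lb ltnS leq_add2l.
      by apply: leq_sum => x /negPf->.
    by exists f; split=> // x; apply: subsetP (fL x); apply: drop_color_sub.
  by have [/(drop c Lc)|/(drop d Ld)] := rado_drop_color (e := e) neq_cd radoL.
move/existsPn => leL1.
have /fin_all_exists[f Lf] (e : E) : exists c, L e = [set c].
  apply/cards1P; have := rado_nonempty e radoL; have := leL1 e; lia.
exists (finfun f); split=> [e|]; first by rewrite ffunE Lf set11.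
apply: rado_singletons => A; apply: leq_trans (radoL A) _; apply: leq_sum => c _.
by apply: rank_mono; apply/subsetP => e; rewrite !inE Lf inE ffunE.
Qed.

(** Double counting of the pairs of an element of [A] and a color in its list gives [k * #|A|] as
    the total size of the sets [allowed L A c]; bound each size by [k] times its rank and cancel
    [k]. *)
Lemma colorable_rado_condition {k L} : 0 < k ->
  (forall c A, #|A| <= k * rank (N c) A) -> (forall e, #|L e| = k) ->
  rado_condition L.
Proof.
move=> k_gt0 leN card_L A; rewrite -(leq_pmul2l k_gt0) big_distrr /=.
suff -> : k * #|A| = \sum_c #|allowed L A c| by apply: leq_sum.
have -> : k * #|A| = \sum_(e in A) \sum_(c in L e) 1.
  by rewrite mulnC -sum_nat_const; apply: eq_bigr => e _; rewrite sum1_card card_L.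
rewrite (exchange_big_dep predT) //=; apply: eq_bigr => c _.
by rewrite sum1dep_card.
Qed.

End ListColoring.

Theorem theorem3 (k t : nat) (k_gt0 : 0 < k) (t_gt0 : 0 < t) (le_kt : k <= t)
  (E : finType) (N : 'I_t -> matroid E)
  (N_loopless : forall i : 'I_t, loopless (N i))
  (chi_N : forall i : 'I_t, chromatic_number (N i) (N_loopless i) <= k)
  (L : E -> {set 'I_t}) (card_L : forall e : E, #|L e| = k) :
  exists f : {ffun E -> 'I_t},
    (forall e : E, f e \in L e) /\
    (forall i : 'I_t, indep (N i) (color_class f i)).
Proof.
apply/rado_list_coloring/(colorable_rado_condition _ _ _ k_gt0) => // i A.
apply: leq_trans (colorable_card_leq _ _ A (chromatic_colorable _ _ (N_loopless i))) _.
by rewrite leq_mul2r chi_N orbT.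
Qed.
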